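(* Let $1/3<p<1/2$ satisfy $$2^{p/(1-p)}\left(\left(\frac{1-p}{p}\right)^{1/(1-p)}-\frac{1-p}{p}\right)-\left(1+\frac{3-1/p}{2}\right)^{1/(1-p)}\ge 0 .$$ Then for every sequence $(a_n)_{n\ge1}$ of non-negative real numbers, $$\sum_{n=1}^{\infty}\left(\frac1n\sum_{k=n}^{\infty}a_k\right)^p\ \ge\ c_p\sum_{n=1}^{\infty}a_n^p\qquad\text{with } c_p=\left(\frac{p}{1-p}\right)^p,$$ and this constant $c_p$ is best possible (the inequality fails for some non-negative sequence if $c_p$ is replaced by any larger constant). In particular, the displayed inequality with $c_p=(p/(1-p))^p$ holds for all non-negative sequences whenever $0<p\le 0.346$.
   Context: All series have non-negative terms and are understood as elements of $[0,\infty]$. *)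

(* Defs.v *)
From HB Require Import structures.
From mathcomp Require Import all_boot all_order all_algebra.
From mathcomp Require Import all_classical all_reals all_analysis.

Set Implicit Arguments.
Unset Strict Implicit.
Unset Printing Implicit Defensive.

Import Order.TTheory GRing.Theory Num.Theory.

Local Open Scope ring_scope.
Local Open Scope ereal_scope.

(* Sequences are indexed from 1; the value a 0 is never used. The tail sums
   live in [0, +oo], and +oo `^ p = +oo for p != 0. *)
Definition copson_lhs (R : realType) (p : R) (a : nat -> R) : \bar R :=
  \sum_(1 <= n <oo) ((n%:R^-1)%:E * \sum_(n <= k <oo) (a k)%:E) `^ p.

Definition copson_rhs (R : realType) (p : R) (a : nat -> R) : \bar R :=
  \sum_(1 <= n <oo) (a n `^ p)%:E.

Definition copson_ineq (R : realType) (p c : R) (a : nat -> R) : Prop :=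
  c%:E * copson_rhs p a <= copson_lhs p a.

Definition nonneg_seq (R : realType) (a : nat -> R) : Prop :=
  forall n, (1 <= n)%N -> (0 <= a n)%R.

(* Main.v *)
(* Write K = (1 - p) / p, s = 1 / (1 - p) and A_n = a_n + a_(n+1) + ... . By
   Hoelder, a_n^p <= u_n^(1-p) A_n^p - (u_n - 1)^(1-p) A_(n+1)^p for every
   u_n >= 1, and summing these bounds gives the inequality as soon as
   u_1^(1-p) <= K^p and u_(n+1)^(1-p) <= (K/(n+1))^p + (u_n - 1)^(1-p).
   - For p <= 1/4 one can take u_n = 1 + n/K.
   - For 1/4 <= p < 1/2 the choice u_n = (n/K) (1 + K/(2n))^s, which agrees with
     the solution of the equality case to the first two orders as n grows,
     satisfies the recursion for all n >= 1; it also satisfies the condition at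
     n = 1 when p <= 1/3. For p > 1/3 one starts from u_1 = K^(p/(1-p)) instead,
     and the hypothesis on p is exactly what makes the step to u_2 work.
   Optimality is seen on the truncations of n^(-1/p), whose right-hand side is a
   partial sum of the harmonic series. *)
Require Import Defs.
From mathcomp Require Import all_boot all_order all_algebra.
From mathcomp Require Import all_classical all_reals all_analysis.
From mathcomp Require Import ring lra.

Import Order.TTheory GRing.Theory Num.Theory.
Import numFieldNormedType.Exports.
Local Open Scope ring_scope.

(** * Calculus and elementary bounds for logarithms and real powers *)

Lemma le_derive_ge0 (R : realType) (f df : R -> R) (a b : R) :
  a <= b -> (forall x, a <= x -> x <= b -> is_derive x 1 f (df x)) ->
  (forall x, a <= x -> x <= b -> 0 <= df x) -> f a <= f b.
Proof.
move=> ab fdf df0; rewrite -subr_ge0.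
have [x||c + ->] := MVT_segment ab (f := f) (df := df).
- by rewrite in_itv/= => /andP[/ltW ax /ltW xb]; exact: fdf.
- apply: derivable_within_continuous => x; rewrite in_itv/= => /andP[ax xb].
  by have [] := fdf _ ax xb.
- by rewrite in_itv/= => /andP[ac cb]; rewrite mulr_ge0 ?subr_ge0 ?df0.
Qed.

(** The difference vanishes at 1 and has derivative [(y - 1)^2 / (y (y + 1)^2)]. *)
Lemma ln_ge_rational (R : realType) (x : R) :
  1 <= x -> 2 * (x - 1) / (x + 1) <= ln x.
Proof.
move=> x1.
pose f (y : R) := ln y - 2 * (y - 1) / (y + 1).
pose df (y : R) := y^-1 - 4 / (y + 1) ^+ 2.
suff : f 1 <= f x by rewrite /f subrr mulr0 mul0r subr0 ln1 subr_ge0.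
apply: (@le_derive_ge0 _ f df) => // y y1 yx.
- have y0 : 0 < y by lra.
  have y10 : y + 1 != 0 by lra.
  have ? : is_derive y 1 (@ln R) y^-1 by exact: is_derive1_ln.
  have ? : is_derive y 1 (fun z : R => (z + 1)^-1) (- ((y + 1) ^- 2)).
    have h : is_derive y 1 (fun z : R => z + 1) 1.
      by apply: is_derive_eq; rewrite addr0.
    have := @is_deriveV _ (fun z : R => z + 1) y 1 1 y10 h.
    by rewrite /GRing.scale/= mulr1.
  apply: is_derive_eq.
  by rewrite /GRing.scale/= /df; field; rewrite y10 gt_eqF.
- have y0 : 0 < y by lra.
  rewrite /df subr_ge0 ler_pdivrMr ?exprn_gt0//; last lra.
  rewrite mulrC ler_pdivlMr//.
  have := sqr_ge0 (y - 1); nra.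
Qed.

Lemma powR_ge1Dln (R : realType) (x r : R) : 0 < x -> 1 + r * ln x <= x `^ r.
Proof. by move=> x0; rewrite /powR gt_eqF// expR_ge1Dx. Qed.

Lemma is_derive_powR_affine (R : realType) (a b r x : R) : 0 < a + b * x ->
  is_derive x 1 (fun y => (a + b * y) `^ r) (r * b * (a + b * x) `^ (r - 1)).
Proof.
move=> h.
have h1 : is_derive x 1 (fun y : R => a + b * y) b.
  by apply: is_derive_eq; rewrite add0r mul1r /GRing.scale/= mulr1.
have h2 := @is_derive1_powR _ r _ h.
have := is_derive1_comp
  (f := fun y : R => y `^ r) (g := fun y : R => a + b * y) h2 h1.
by rewrite mulrAC.
Qed.

Lemma powRD1 (R : realType) (x r : R) : 0 < x -> x `^ (r + 1) = x * x `^ r.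
Proof.
move=> x0; rewrite powRD; last by rewrite (gt_eqF x0) implybT.
by rewrite powRr1 ?ltW// mulrC.
Qed.

(** * The second-order inequality behind the weights for [1/4 <= p < 1/2] *)

Lemma perspective_gt0 (R : realType) (s x : R) :
  1 / 3 <= s -> 0 <= x -> 2 * s * x <= 1 -> 0 < 1 + (2 * s - 1) * x.
Proof.
move=> s3 x0 sx; have xs3 : x <= 3 / 2 by nra.
nra.
Qed.

(** Taking reciprocals turns this into [(1 + x)^(1 - s) <= A^(2 + s) B^(1 - s)], which follows from
    [1 + x <= A^3 B] because [A >= 1] and [3 (1 - s) <= 2 + s]. *)
Lemma powR_weighted_le (R : realType) (s x : R) :
  1 / 3 <= s -> s <= 1 -> 0 <= x -> 2 * s * x <= 1 ->
  (1 + 2 * s * x) `^ (- s - 2) * (1 + (2 * s - 1) * x) `^ (s - 1)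
  <= (1 + x) `^ (s - 1).
Proof.
move=> s3 s1 x0 sx.
set A := 1 + 2 * s * x; set B := 1 + (2 * s - 1) * x.
have A1 : 1 <= A by rewrite /A lerDl; nra.
have B0 : 0 < B by exact: perspective_gt0.
have x10 : 0 < 1 + x by lra.
have A0 : 0 < A by lra.
(* With [u = 2 s x] in [[0, 1]] one has [x <= 3u/2] and hence [B >= 1 - u/2]; a polynomial
   inequality in [u] alone remains. *)
have key : 1 + x <= A ^+ 3 * B.
  set u := 2 * s * x; have u0 : 0 <= u by rewrite /u; nra.
  have u1 : u <= 1 by [].
  have xu : x <= 3 / 2 * u by rewrite /u; nra.
  have hB : 1 - u / 2 <= B by rewrite /B mulrBl -/u mul1r; lra.
  have hA : 1 + 3 / 2 * u <= (1 + u) ^+ 3 * (1 - u / 2).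
    have u21 : u ^+ 2 <= 1 by rewrite expr_le1.
    have : 0 <= u * (1 - u ^+ 2) by rewrite mulr_ge0// subr_ge0.
    have : 0 <= u ^+ 2 * (1 - u ^+ 2) by rewrite mulr_ge0 ?sqr_ge0// subr_ge0.
    nra.
  apply: (@le_trans _ _ ((1 + u) ^+ 3 * (1 - u / 2))); first lra.
  by rewrite -/u ler_wpM2l ?exprn_ge0//; lra.
have -> : - s - 2 = - (2 + s) by ring.
have -> : s - 1 = - (1 - s) by ring.
rewrite !powRN -invfM lef_pV2 ?posrE ?mulr_gt0 ?powR_gt0//.
have h : (1 + x) `^ (1 - s) <= (A ^+ 3 * B) `^ (1 - s).
  by apply: ge0_ler_powR; rewrite ?nnegrE ?subr_ge0// ltW// (lt_le_trans x10).
apply: le_trans h _.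
rewrite powRM ?exprn_ge0 ?(ltW A0) ?(ltW B0)//.
rewrite ler_pM2r ?powR_gt0// -powR_mulrn ?(ltW A0)// -powRrM.
by apply: ler_powR => //; lra.
Qed.

(* With y' = y / (1 + 2 s y), the second summand is (1 + 2 s y) (1 - y')^(1+s),
   a perspective of z |-> (1 - z)^(1+s); its second derivative is therefore
   (1 + s) s (1 - y')^(s-1) / (1 + 2 s y)^3. The difference of the two sides
   and its derivative vanish at 0, and powR_weighted_le makes it convex. *)
Lemma powR_second_order_gap (R : realType) (s y : R) :
  1 / 3 <= s -> s <= 1 -> 0 <= y -> 2 * s * y <= 1 ->
  2 * y + (1 + 2 * s * y) `^ (- s) * (1 + (2 * s - 1) * y) `^ (1 + s)
  <= (1 + y) `^ (1 + s).
Proof.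
move=> s3 s1 y0 sy.
pose A (x : R) := 1 + 2 * s * x; pose B (x : R) := 1 + (2 * s - 1) * x.
pose G x := (1 + 1 * x) `^ (1 + s) - 2 * x - (A x) `^ (- s) * (B x) `^ (1 + s).
pose dG x := (1 + s) * (1 + 1 * x) `^ s - 2
  - ((A x) `^ (- s - 1) * (B x) `^ s) * (s - 1 + 2 * s * (2 * s - 1) * x).
pose ddG x := (1 + s) * s * ((1 + x) `^ (s - 1)
  - (A x) `^ (- s - 2) * (B x) `^ (s - 1)).
have posA x : 0 <= x -> x <= y -> 0 < A x.
  by move=> x0 xy; rewrite /A ltr_wpDr// !mulr_ge0//; lra.
have posB x : 0 <= x -> x <= y -> 0 < B x.
  move=> x0 xy; apply: perspective_gt0 => //.
  by apply: le_trans sy; rewrite ler_wpM2l//; lra.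
have pos1 x : 0 <= x -> 0 < 1 + 1 * x :> R by lra.
(* The powers of [A] and [B] are reduced to their lowest exponents, so that the derivative
   identities below become polynomial and [ring] closes them. *)
have hA1 x : 0 < A x -> A x `^ (- s - 1) = A x * A x `^ (- s - 2).
  by move=> /(powRD1 _ _ (- s - 2)) <-; congr (_ `^ _); ring.
have hA0 x : 0 < A x -> A x `^ (- s) = A x * (A x * A x `^ (- s - 2)).
  by move=> h; rewrite -hA1// -powRD1//; congr (_ `^ _); ring.
have hB1 x : 0 < B x -> B x `^ s = B x * B x `^ (s - 1).
  by move=> h; rewrite -powRD1//; congr (_ `^ _); ring.
have hB2 x : 0 < B x -> B x `^ (1 + s) = B x * (B x * B x `^ (s - 1)).
  by move=> h; rewrite -hB1// -powRD1//; congr (_ `^ _); ring.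
have G' x : 0 <= x -> x <= y -> is_derive x 1 G (dG x).
  move=> x0 xy; have Ax := posA _ x0 xy; have Bx := posB _ x0 xy.
  have d1 := is_derive_powR_affine _ 1 1 (1 + s) x (pos1 _ x0).
  have d2 := is_derive_powR_affine _ 1 (2 * s) (- s) x Ax.
  have d3 := is_derive_powR_affine _ 1 (2 * s - 1) (1 + s) x Bx.
  apply: is_derive_eq.
  rewrite /dG /GRing.scale/= -/(A x) -/(B x).
  have -> : 1 + s - 1 = s by ring.
  rewrite hA0// hB2// hA1// hB1//.
  by rewrite /A /B; ring.
have dG' x : 0 <= x -> x <= y -> is_derive x 1 dG (ddG x).
  move=> x0 xy; have Ax := posA _ x0 xy; have Bx := posB _ x0 xy.
  have d1 := is_derive_powR_affine _ 1 1 s x (pos1 _ x0).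
  have d2 := is_derive_powR_affine _ 1 (2 * s) (- s - 1) x Ax.
  have d3 := is_derive_powR_affine _ 1 (2 * s - 1) s x Bx.
  apply: is_derive_eq.
  rewrite /ddG /GRing.scale/= -/(A x) -/(B x).
  have -> : - s - 1 - 1 = - s - 2 by ring.
  rewrite hA1// hB1// [1 * x]mul1r.
  by rewrite /A /B; ring.
have ddG0 x : 0 <= x -> x <= y -> 0 <= ddG x.
  move=> x0 xy; rewrite /ddG mulr_ge0//; first by rewrite mulr_ge0//; lra.
  rewrite subr_ge0; apply: powR_weighted_le => //.
  by apply: le_trans sy; rewrite ler_wpM2l//; lra.
have dG0 x : 0 <= x -> x <= y -> 0 <= dG x.
  move=> x0 xy; have -> : 0 = dG 0.
    by rewrite /dG /A /B !mulr0 !addr0 !powR1; ring.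
  by apply: (@le_derive_ge0 _ _ ddG) => // z z0 zx;
    [apply: dG'|apply: ddG0] => //; exact: le_trans zx xy.
suff : G 0 <= G y.
  rewrite /G /A /B !mulr0 !addr0 !powR1 [1 * y]mul1r; lra.
by apply: (@le_derive_ge0 _ _ dG).
Qed.

(** * Reduction of the inequality to a recursion for weights *)

(** Hoelder with exponents [1/(1 - p)] and [1/p] for the pairs [(1, (u - 1)^(1 - p))] and
    [(a^p, b^p)]; the first pair has norm [u^(1 - p)]. *)
Lemma powR_hoelder_step (R : realType) (p u a b : R) :
  0 < p -> p < 1 -> 1 <= u -> 0 <= a -> 0 <= b ->
  a `^ p + (u - 1) `^ (1 - p) * b `^ p <= u `^ (1 - p) * (a + b) `^ p.
Proof.
move=> p0 p1 u1 a0 b0.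
have q0 : 0 < 1 - p by lra.
have u10 : 0 <= u - 1 by lra.
have := @hoelder2 R 1 ((u - 1) `^ (1 - p)) (a `^ p) (b `^ p) (1 - p)^-1 p^-1
  ler01 (powR_ge0 _ _) (powR_ge0 _ _) (powR_ge0 _ _).
rewrite !invr_gt0 !invrK => /(_ q0 p0 (subrK _ _)).
rewrite mul1r powR1 -!powRrM !divff ?gt_eqF// !powRr1//.
by rewrite addrCA subrr addr0.
Qed.

Lemma copson_partial_sums (R : realType) (p : R) (u a A : nat -> R) (N : nat) :
  0 < p -> p < 1 ->
  (forall n, (1 <= n)%N -> 1 <= u n) ->
  u 1%N `^ (1 - p) <= ((1 - p) / p) `^ p ->
  (forall n, (1 <= n)%N -> u n.+1 `^ (1 - p) <=
     ((1 - p) / p / n.+1%:R) `^ p + (u n - 1) `^ (1 - p)) ->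
  (forall n, (1 <= n)%N -> 0 <= a n) -> (forall n, (1 <= n)%N -> 0 <= A n) ->
  (forall n, (1 <= n)%N -> A n = a n + A n.+1) ->
  \sum_(1 <= n < N.+1) a n `^ p <=
  \sum_(1 <= n < N.+1) ((1 - p) / p / n%:R) `^ p * A n `^ p.
Proof.
move=> p0 p1 u1 base step a0 A0 AS.
case: N => [|N]; first by rewrite !big_nil.
(* The induction keeps the leftover of the last Hoelder bound: it pays for the excess of
   [u_(N+2)^(1 - p)] over [(K/(N+2))^p] in the next step. *)
suff : \sum_(1 <= n < N.+2) a n `^ p + (u N.+1 - 1) `^ (1 - p) * A N.+2 `^ p
   <= \sum_(1 <= n < N.+2) ((1 - p) / p / n%:R) `^ p * A n `^ p.
  by apply: le_trans; rewrite lerDl mulr_ge0 ?powR_ge0.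
elim: N => [|N IH].
  rewrite !big_nat1 divr1.
  apply: (@le_trans _ _ (u 1%N `^ (1 - p) * A 1%N `^ p)).
    rewrite (AS 1%N)//.
    by apply: powR_hoelder_step => //; [exact: u1|exact: a0|exact: A0].
  by rewrite ler_wpM2r ?powR_ge0.
rewrite (big_nat_recr N.+2)//= [leRHS](big_nat_recr N.+2)//=.
have h1 := @powR_hoelder_step R p (u N.+2) (a N.+2) (A N.+3) p0 p1
  (u1 N.+2 isT) (a0 N.+2 isT) (A0 N.+3 isT).
rewrite -AS// in h1.
have h2 : u N.+2 `^ (1 - p) * A N.+2 `^ p <=
  (((1 - p) / p / N.+2%:R) `^ p + (u N.+1 - 1) `^ (1 - p)) * A N.+2 `^ p.
  by rewrite ler_wpM2r ?powR_ge0// step.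
rewrite mulrDl in h2.
lra.
Qed.

Lemma copson_ineq_of_weights (R : realType) (p : R) (u a : nat -> R) :
  0 < p -> p < 1 ->
  (forall n, (1 <= n)%N -> 1 <= u n) ->
  u 1%N `^ (1 - p) <= ((1 - p) / p) `^ p ->
  (forall n, (1 <= n)%N -> u n.+1 `^ (1 - p) <=
     ((1 - p) / p / n.+1%:R) `^ p + (u n - 1) `^ (1 - p)) ->
  nonneg_seq a -> copson_ineq p ((p / (1 - p)) `^ p) a.
Proof.
move=> p0 p1 u1 base step a0; rewrite /copson_ineq /copson_rhs /copson_lhs.
pose T n : \bar R := (\sum_(n <= k <oo) (a k)%:E)%E.
have T0 n : (1 <= n)%N -> (0 <= T n)%E.
  move=> n1; apply: nneseries_ge0 => k nk _.
  by rewrite lee_fin a0// (leq_trans n1).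
have TS n : (1 <= n)%N -> (T n = (a n)%:E + T n.+1)%E.
  move=> n1; rewrite /T (nneseries_split n 1); last first.
    by move=> k nk; rewrite lee_fin a0// (leq_trans n1).
  by rewrite addn1 big_nat1.
have lhs0 n : (0 <= ((n%:R^-1)%:E * T n) `^ p)%E by exact: poweR_ge0.
(* If the whole series diverges, the term [n = 1] alone makes the left-hand side infinite; otherwise
   every tail is finite and can be treated as a real. *)
have [Too|Tfin] := eqVneq (T 1%N) +oo%E.
  have -> : (\sum_(1 <= n <oo) ((n%:R^-1)%:E * T n) `^ p = +oo)%E.
    apply/eqP; rewrite -leye_eq.
    apply: (le_trans _ (nneseries_lim_ge 2 (fun n _ _ => lhs0 n))).
    by rewrite big_nat1 Too invr1 mul1e poweRyr ?gt_eqF.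
  exact: leey.
have finT n : (1 <= n)%N -> T n \is a fin_num.
  case: n => // n _; elim: n => [|n IH].
    by rewrite ge0_fin_numE ?T0// ltey.
  by move: IH; rewrite TS// fin_numD => /andP[].
pose A n := fine (T n).
have TA n : (1 <= n)%N -> T n = (A n)%:E by move=> n1; rewrite fineK ?finT.
have A0 n : (1 <= n)%N -> 0 <= A n by move=> n1; rewrite fine_ge0 ?T0.
have AS n : (1 <= n)%N -> A n = a n + A n.+1.
  by move=> n1; apply: EFin_inj; rewrite EFinD -!TA// TS.
rewrite -nneseriesZl; last by move=> i _; rewrite lee_fin powR_ge0.
apply: lime_le.
  by apply: is_cvg_nneseries => n _ _; rewrite mule_ge0 ?lee_fin ?powR_ge0.
apply: nearW => N.
apply: (le_trans _ (nneseries_lim_ge N (fun n _ _ => lhs0 n))).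
have -> : (\sum_(1 <= i < N) ((i%:R^-1)%:E * T i) `^ p
  = (\sum_(1 <= i < N) (A i / i%:R) `^ p)%:E)%E.
  rewrite -sumEFin; apply: eq_big_nat => i /andP[i1 _].
  by rewrite TA// -EFinM poweR_EFin mulrC.
rewrite -ge0_sume_distrr; last by move=> i _; rewrite lee_fin powR_ge0.
rewrite sumEFin -EFinM lee_fin.
case: N => [|N]; first by rewrite !big_geq// mulr0.
have K0 : 0 <= (1 - p) / p by rewrite divr_ge0//; lra.
have c0 : 0 <= p / (1 - p) by rewrite divr_ge0//; lra.
have := @copson_partial_sums R p u a A N p0 p1 u1 base step a0 A0 AS.
move=> /(ler_wpM2l (powR_ge0 (p / (1 - p)) p)) /le_trans; apply.
rewrite mulr_sumr; apply: ler_sum_nat => i /andP[i1 _].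
have Ai0 : 0 <= A i / i%:R by rewrite divr_ge0 ?A0.
have Ki0 : 0 <= (1 - p) / p / i%:R by rewrite divr_ge0.
rewrite -(powRM _ Ki0) ?A0// -(powRM _ c0); last by rewrite mulr_ge0 ?A0.
suff -> : p / (1 - p) * ((1 - p) / p / i%:R * A i) = A i / i%:R by [].
have i0 : i%:R != 0 :> R by rewrite pnatr_eq0 -lt0n.
by field; rewrite i0 !gt_eqF//; lra.
Qed.

(** * Weights for [p] between [1/4] and [1/2] *)

Definition copson_weight (R : realType) (p x : R) : R :=
  x / ((1 - p) / p) * (1 + (1 - p) / p / (2 * x)) `^ (1 - p)^-1.

(** With [z = n/K] this extracts from [(K/n)^p] the factor [z^(1 - p)] by which the whole recursion
    is then divided. *)
Lemma powR_slope (R : realType) (p z : R) : 0 < z ->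
  z^-1 `^ p = z `^ (1 - p) * z^-1.
Proof.
move=> z0; rewrite -[z^-1 in RHS]powR_inv1 ?ltW//.
rewrite -powRD; last by rewrite (gt_eqF z0) implybT.
by rewrite addrAC subrr add0r -powR_inv1 ?ltW// -powRrM mulN1r.
Qed.

Lemma copson_weight_powR (R : realType) (p x : R) : 0 < p -> p < 1 -> 0 < x ->
  copson_weight R p x `^ (1 - p) =
  (x / ((1 - p) / p)) `^ (1 - p) * (1 + (1 - p) / p / (2 * x)).
Proof.
move=> p0 p1 x0; have q0 : 0 < 1 - p by lra.
have K0 : 0 < (1 - p) / p by rewrite divr_gt0.
have y0 : 0 < 1 + (1 - p) / p / (2 * x).
  by rewrite addr_gt0// divr_gt0// mulr_gt0.
rewrite /copson_weight powRM ?powR_ge0//; last by rewrite ltW// divr_gt0.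
by rewrite -powRrM mulVf ?gt_eqF// powRr1 1?ltW.
Qed.

(** Divided by [(x/K)^(1 - p)], with [t = K/(2x)], the conclusion reads
    [1 + t <= 2t + (yK/x)^(1 - p)], which is the last hypothesis raised to the power [1 - p]. Here
    [y] stands for the preceding weight minus one; it is left free because [u_1] is chosen
    differently when [p > 1/3]. *)
Lemma copson_weight_step (R : realType) (p x y : R) :
  0 < p -> p < 1 -> 0 < x -> (1 - p) / p <= 2 * x ->
  x / ((1 - p) / p) * (1 - (1 - p) / p / (2 * x)) `^ (1 - p)^-1 <= y ->
  copson_weight R p x `^ (1 - p) <=
  ((1 - p) / p / x) `^ p + y `^ (1 - p).
Proof.
move=> p0 p1 x0 Kx hy; have q0 : 0 < 1 - p by lra.
rewrite copson_weight_powR//.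
set K := (1 - p) / p in Kx hy *.
have K0 : 0 < K by rewrite divr_gt0.
have z0 : 0 < x / K by rewrite divr_gt0.
have y1 : 0 <= 1 - K / (2 * x) by rewrite subr_ge0 ler_pdivrMr ?mul1r ?mulr_gt0.
have := ge0_ler_powR (ltW q0) _ _ hy.
rewrite !nnegrE (le_trans _ hy) mulr_ge0 ?powR_ge0 ?(ltW z0)// => /(_ isT isT).
rewrite powRM ?powR_ge0 ?(ltW z0)// -powRrM mulVf ?gt_eqF// powRr1// => h.
have -> : K / x = (x / K)^-1 by rewrite invf_div.
rewrite powR_slope//.
have -> : (x / K)^-1 = 2 * (K / (2 * x)) by field; rewrite !gt_eqF.
lra.
Qed.

(** This is [powR_second_order_gap] at [s = p/(1 - p)] and [y = K/(2x)], multiplied by [x/K]: then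
    [2 s y = 1/x], the summand [2y] becomes 1, and [1/4 <= p <= 1/2] means [1/3 <= s <= 1]. *)
Lemma copson_weight_gap (R : realType) (p x : R) :
  1 / 4 <= p -> p <= 1 / 2 -> 1 <= x ->
  (x + 1) / ((1 - p) / p) * (1 - (1 - p) / p / (2 * (x + 1))) `^ (1 - p)^-1
  <= copson_weight R p x - 1.
Proof.
move=> p4 p2 x1; have p0 : 0 < p by lra.
have q0 : 0 < 1 - p by lra.
have x0 : 0 < x by lra.
have K0 : 0 < (1 - p) / p by rewrite divr_gt0.
pose s := p / (1 - p); pose y := (1 - p) / p / (2 * x).
have s3 : 1 / 3 <= s by rewrite ler_pdivlMr//; lra.
have s1 : s <= 1 by rewrite ler_pdivrMr//; lra.
have y0 : 0 <= y by rewrite ltW// divr_gt0// mulr_gt0.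
have syE : 2 * s * y = x^-1 by rewrite /s /y; field; rewrite !gt_eqF.
have sy : 2 * s * y <= 1 by rewrite syE invf_le1.
have := powR_second_order_gap _ _ _ s3 s1 y0 sy.
have B0 := perspective_gt0 _ _ _ s3 y0 sy.
have A0 : 0 < 1 + 2 * s * y by rewrite syE addr_gt0 ?invr_gt0.
have sE : 1 + s = (1 - p)^-1 by rewrite /s; field; rewrite gt_eqF.
have -> : (1 + 2 * s * y) `^ (- s) * (1 + (2 * s - 1) * y) `^ (1 + s) =
  (1 + x^-1) * (1 - (1 - p) / p / (2 * (x + 1))) `^ (1 - p)^-1.
  have -> : 1 - (1 - p) / p / (2 * (x + 1)) =
     (1 + (2 * s - 1) * y) / (1 + 2 * s * y).
    rewrite syE /s /y; field; rewrite !gt_eqF//; lra.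
  rewrite powRM ?invr_ge0 ?(ltW A0) ?(ltW B0)// -sE.
  rewrite -[(1 + 2 * s * y)^-1]powR_inv1 ?(ltW A0)// -powRrM -syE mulN1r.
  have -> : - (1 + s) = - s - 1 by ring.
  have -> : (1 + 2 * s * y) `^ (- s) =
      (1 + 2 * s * y) * (1 + 2 * s * y) `^ (- s - 1).
    by rewrite -powRD1//; congr (_ `^ _); ring.
  by rewrite -mulrA [X in _ * X = _]mulrC.
rewrite sE /copson_weight -/y => h.
rewrite lerBrDr; have z0 : 0 < x / ((1 - p) / p) by rewrite divr_gt0.
have := ler_wpM2l (ltW z0) h; apply: le_trans.
rewrite le_eqVlt; apply/orP; left; apply/eqP.
rewrite /y; field; rewrite !gt_eqF//; lra.
Qed.

Lemma copson_weight_ge1 (R : realType) (p x : R) :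
  1 / 4 <= p -> p <= 1 / 2 -> 1 <= x -> 1 <= copson_weight R p x.
Proof.
move=> p4 p2 x1; rewrite -subr_ge0.
apply: le_trans (copson_weight_gap _ _ _ p4 p2 x1).
by rewrite mulr_ge0 ?powR_ge0// divr_ge0 ?divr_ge0//; lra.
Qed.

Lemma copson_weight_succ (R : realType) (p : R) (n : nat) :
  1 / 4 <= p -> p < 1 / 2 -> (1 <= n)%N ->
  copson_weight R p n.+1%:R `^ (1 - p) <=
  ((1 - p) / p / n.+1%:R) `^ p + (copson_weight R p n%:R - 1) `^ (1 - p).
Proof.
move=> p4 p2 n1; have x1 : 1 <= n%:R :> R by rewrite ler1n.
have K3 : (1 - p) / p <= 3 by rewrite ler_pdivrMr; lra.
rewrite -natr1; apply: copson_weight_step; [lra|lra|lra|lra|].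
by apply: copson_weight_gap => //; lra.
Qed.

Lemma copson_ineq_quarter_third (R : realType) (p : R) (a : nat -> R) :
  1 / 4 <= p -> p <= 1 / 3 -> nonneg_seq a ->
  copson_ineq p ((p / (1 - p)) `^ p) a.
Proof.
move=> p4 p3; have p0 : 0 < p by lra.
apply: (@copson_ineq_of_weights _ _ (fun n => copson_weight R p n%:R)) => //.
- lra.
- by move=> n n1; apply: copson_weight_ge1; rewrite ?ler1n//; lra.
(* Without the common factor [(1/K)^(1 - p)] the condition at [n = 1] is [1 + K/2 <= K], that is,
   [p <= 1/3]. *)
- have K2 : 2 <= (1 - p) / p by rewrite ler_pdivlMr//; lra.
  rewrite copson_weight_powR//; last lra.
  set K := (1 - p) / p in K2 *.
  have K0 : 0 < K by lra.
  rewrite mulr1 mul1r -[K in leRHS]invrK (powR_slope _ p) ?invr_gt0// invrK.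
  by rewrite ler_wpM2l ?powR_ge0//; lra.
- by move=> n n1; apply: copson_weight_succ => //; lra.
Qed.

Lemma copson_ineq_third_half (R : realType) (p : R) (a : nat -> R) :
  1 / 3 < p -> p < 1 / 2 ->
  0 <= 2 `^ (p / (1 - p))
         * (((1 - p) / p) `^ (1 / (1 - p)) - (1 - p) / p)
       - (1 + (3 - 1 / p) / 2) `^ (1 / (1 - p)) ->
  nonneg_seq a -> copson_ineq p ((p / (1 - p)) `^ p) a.
Proof.
move=> p3 p2; have p0 : 0 < p by lra.
have q0 : 0 < 1 - p by lra.
set K := (1 - p) / p => hyp.
have K1 : 1 <= K by rewrite ler_pdivlMr//; lra.
have K2 : K <= 2 by rewrite ler_pdivrMr//; lra.
have K0 : 0 < K by lra.
(* The first weight is the largest one that the condition at [n = 1] permits. *)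
pose u (n : nat) : R :=
  if n == 1%N then K `^ (p / (1 - p)) else copson_weight R p n%:R.
apply: (@copson_ineq_of_weights _ _ u) => //.
- lra.
- move=> n n1; rewrite /u; case: eqP => _; last first.
    by apply: copson_weight_ge1; rewrite ?ler1n//; lra.
  by rewrite -[leLHS](powRr0 K) ler_powR// divr_ge0// ltW.
- by rewrite /u/= -powRrM divfK ?gt_eqF.
- move=> [|[|n]] // _; last by apply: copson_weight_succ => //; lra.
  rewrite /u/= -/K; apply: copson_weight_step => //; rewrite -/K; [lra..|].
  (* With [s = 1/(1 - p)], the hypothesis divided by [2^(s - 1)] is [K^s - K >= 2 (1 - K/4)^s];
     dividing by [K] gives the bound required of [u_1 - 1]. *)
  have t0 : 0 <= 1 - K / (2 * 2) by lra.
  have E1 : 1 + (3 - 1 / p) / 2 = 2 * (1 - K / (2 * 2)).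
    by rewrite /K; field; rewrite gt_eqF.
  have sE : 1 / (1 - p) = p / (1 - p) + 1 by field; rewrite gt_eqF.
  rewrite E1 (powRM _ _ t0)// sE (powRD1 _ 2)// (powRD1 _ K)// -sE div1r in hyp.
  have P2 : 0 < 2 `^ (p / (1 - p)) :> R by rewrite powR_gt0.
  move: hyp; rewrite -mulrA (mulrCA 2) -mulrBr pmulr_rge0// subr_ge0 => hyp.
  rewrite lerBrDr mulrAC -lerBrDr ler_pdivrMr// mulrBl mul1r.
  by rewrite [_ * K]mulrC.
Qed.

(** * Affine weights for [p <= 1/4] *)

(** The recursion for [u_n = 1 + n/K] divided by [((n+1)/K)^(1 - p)], with [x = 1/(n+1)]. Both
    powers are replaced by rational bounds obtained from estimates of the logarithm. *)
Lemma powR_affine_small (R : realType) (p x : R) :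
  0 < p -> p <= 1 / 4 -> 0 < x -> x <= 1 / 2 ->
  (1 + (1 - p) / p * x) `^ (1 - p) <= (1 - p) / p * x + (1 - x) `^ (1 - p).
Proof.
move=> p0 p4 x0 x2; set K := (1 - p) / p; set y := K * x.
have K3 : 3 <= K by rewrite ler_pdivlMr//; lra.
have pK : p * K = 1 - p by rewrite /K mulrC divfK ?gt_eqF.
have y0 : 0 < y by rewrite mulr_gt0//; lra.
have y10 : 0 < 1 + y by lra.
have z0 : 0 < 1 - x by lra.
have lower : (1 - x) * (1 + p * x) <= (1 - x) `^ (1 - p).
  rewrite [1 - p]addrC powRD1// ler_wpM2l ?(ltW z0)//.
  apply: (le_trans _ (powR_ge1Dln _ _ _ z0)).
  have := @le_ln1Dx R (- x); nra.
have up : (1 + y) `^ (1 - p) * (2 + y + 2 * p * y) <= (1 + y) * (2 + y).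
  rewrite [1 - p]addrC powRD1// powRN -mulrA ler_wpM2l ?(ltW y10)//.
  rewrite mulrC ler_pdivrMr ?powR_gt0//.
  have h1 := powR_ge1Dln _ (1 + y) p y10.
  have h2 : 2 * y / (2 + y) <= ln (1 + y).
    have := @ln_ge_rational R (1 + y); rewrite addrAC subrr add0r.
    have -> : 1 + y + 1 = 2 + y by ring.
    by apply; lra.
  have h3 : 2 * y <= (2 + y) * ln (1 + y).
    by rewrite [leRHS]mulrC -ler_pdivrMr//; lra.
  apply: (@le_trans _ _ ((2 + y) * (1 + p * ln (1 + y)))).
    rewrite mulrDr mulr1 (mulrCA _ p) lerD2l mulrAC mulrC.
    by rewrite ler_wpM2l ?(ltW p0).
  by rewrite ler_wpM2l//; lra.
apply: (@le_trans _ _ (y + (1 - x) * (1 + p * x))); last by rewrite lerD2l.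
have py0 : 0 < p * y by rewrite mulr_gt0.
have d0 : 0 < 2 + y + 2 * p * y by lra.
rewrite -(ler_pM2r d0); apply: le_trans up _.
rewrite -subr_ge0.
(* All terms of order below two in [x] cancel; the last factor is at least [K^2/2 - 2 - 3K/4], which
   is positive for [K >= 3]. *)
have -> : (y + (1 - x) * (1 + p * x)) * (2 + y + 2 * p * y) - (1 + y) * (2 + y)
  = p * x ^+ 2 * ((1 - 2 * p) * K ^+ 2 - 2 - (1 + 2 * p) * K * x).
  have -> : K = (1 - p) / p by [].
  rewrite /y /K; field; lra.
apply: mulr_ge0; first by rewrite mulr_ge0 ?sqr_ge0// ltW.
have : 1 / 2 * K ^+ 2 <= (1 - 2 * p) * K ^+ 2.
  by rewrite ler_wpM2r ?sqr_ge0//; lra.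
have : (1 + 2 * p) * K * x <= 3 / 2 * K * (1 / 2).
  have hK : (1 + 2 * p) * K <= 3 / 2 * K by rewrite ler_wpM2r//; lra.
  by apply: ler_pM => //; [rewrite mulr_ge0//; lra|exact: ltW].
nra.
Qed.

Lemma copson_ineq_small (R : realType) (p : R) (a : nat -> R) :
  0 < p -> p <= 1 / 4 -> nonneg_seq a -> copson_ineq p ((p / (1 - p)) `^ p) a.
Proof.
move=> p0 p4; have q0 : 0 < 1 - p by lra.
pose K := (1 - p) / p.
have K3 : 3 <= K by rewrite ler_pdivlMr//; lra.
have K0 : 0 < K by lra.
have pK : p * K = 1 - p by rewrite /K mulrC divfK ?gt_eqF.
apply: (@copson_ineq_of_weights _ _ (fun n => 1 + n%:R / K)) => //;
  rewrite -?/K.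
- lra.
- by move=> n _; rewrite lerDl divr_ge0// ltW.
(* After taking logarithms and using [1 - p = p K], the condition at [n = 1] is
   [K ln (1 + 1/K) <= ln K]; the left side is at most 1, and [ln K >= ln 3 >= 1]. *)
- rewrite /powR !gt_eqF ?addr_gt0 ?divr_gt0// ler_expR -pK -mulrA.
  rewrite ler_wpM2l ?(ltW p0)//.
  have h1 : ln (1 + 1 / K) <= 1 / K.
    by apply: le_ln1Dx; rewrite (lt_le_trans (ltrN10 _))// divr_ge0 // ltW.
  have h2 : 1 <= ln K.
    have := @ln_ge_rational R 3; rewrite ler1n => /(_ isT) h3.
    apply: (@le_trans _ _ (ln 3)).
      by apply: le_trans h3; rewrite ler_pdivlMr; lra.
    by rewrite ler_ln ?posrE//; lra.
  apply: le_trans h2; rewrite -ler_pdivlMl//. lra.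
- move=> n n1; rewrite -/K addrAC subrr add0r.
  set m : R := n.+1%:R; have m0 : 0 < m by rewrite ltr0n.
  have m2 : 2 <= m by rewrite ler_nat.
  have -> : n%:R = m - 1 :> R by rewrite /m -natr1 addrK.
  have x2 : m^-1 <= 1 / 2 by rewrite div1r lef_pV2 ?posrE.
  have x0 : 0 < m^-1 by rewrite invr_gt0.
  have := powR_affine_small _ _ _ p0 p4 x0 x2; rewrite -/K => h.
  have Km0 : 0 < m / K by rewrite divr_gt0.
  have := ler_wpM2l (powR_ge0 (m / K) (1 - p)) h.
  have Km1 : 0 <= 1 + K * m^-1 by rewrite addr_ge0// ltW// mulr_gt0.
  have m1 : 0 <= 1 - m^-1 by rewrite subr_ge0 (le_trans x2)//; lra.
  rewrite mulrDr -(powRM _ (ltW Km0) Km1) -(powRM _ (ltW Km0) m1).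
  have -> : m / K * (1 + K / m) = 1 + m / K by field; rewrite !gt_eqF.
  have -> : m / K * (1 - m^-1) = (m - 1) / K by field; rewrite !gt_eqF.
  have -> : K / m = (m / K)^-1 by rewrite invf_div.
  by rewrite powR_slope.
Qed.

(** * Numerical bounds for the criterion at [k = (1 - p)/p] *)

Lemma powR_inv_split (R : realType) (x k : R) : 0 < x ->
  x `^ k^-1 = Num.sqrt x * x `^ (k^-1 - 2^-1).
Proof.
move=> x0; rewrite -powR12_sqrt ?ltW// -powRD; last first.
  by rewrite (gt_eqF x0) implybT.
by rewrite subrKC.
Qed.

Lemma inv_sub_half (R : realType) (k : R) : 0 < k -> k <= 2 ->
  0 <= k^-1 - 2^-1 /\ (k^-1 - 2^-1) * k = 1 - k / 2.
Proof.
move=> k0 k2; split; last by field; rewrite gt_eqF.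
by rewrite subr_ge0 lef_pV2 ?posrE.
Qed.

(* For k close to 2 the exponents 1/k are close to 1/2: powers of exponent 1/k
   are bounded as a square root times a factor x^(1/k - 1/2) close to 1. The
   affine bounds below are tight at the endpoint k = 327/173, i.e. p = 346/1000,
   where the two sides of copson_threshold differ by only about 0.005. *)
Lemma powR_excess_ge (R : realType) (k : R) : 1 <= k -> k <= 2 ->
  (4 * k - 2) / (k + 1) <= k * k `^ (k^-1 - 2^-1).
Proof.
move=> k1 k2; have k0 : 0 < k by lra.
have k10 : k + 1 != 0 by lra.
have [d0 dk] := inv_sub_half _ _ k0 k2.
have h1 := powR_ge1Dln _ k (k^-1 - 2^-1) k0.
have h2 := ln_ge_rational _ k k1.
apply: (@le_trans _ _ (k * (1 + (k^-1 - 2^-1) * (2 * (k - 1) / (k + 1))))).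
  rewrite mulrDr mulr1 mulrA (mulrC k (k^-1 - 2^-1)) dk.
  by rewrite le_eqVlt; apply/orP; left; apply/eqP; field.
rewrite ler_wpM2l ?(ltW k0)//; apply: le_trans h1.
by rewrite lerD2l ler_wpM2l.
Qed.

(** The base is below 1, so the rational bound for the logarithm is applied to its reciprocal and
    the resulting lower bound is inverted. *)
Lemma powR_deficit_le (R : realType) (k : R) : 0 < k -> k <= 2 ->
  (1 - k / 4) `^ (k^-1 - 2^-1) <= (8 - k) / (10 - 2 * k).
Proof.
move=> k0 k2; have [d0 dk] := inv_sub_half _ _ k0 k2.
set d := k^-1 - 2^-1 in d0 dk *.
have z0 : 0 < 1 - k / 4 by lra.
have k40 : 4 - k != 0 by lra.
have k80 : 8 - k != 0 by lra.
have zV0 : 0 < (1 - k / 4)^-1 by rewrite invr_gt0.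
have h1 := powR_ge1Dln _ _ d zV0.
have h2 : 2 * k / (8 - k) <= ln (1 - k / 4)^-1.
  have -> : 2 * k / (8 - k) =
      2 * ((1 - k / 4)^-1 - 1) / ((1 - k / 4)^-1 + 1).
    by field; rewrite k40; lra.
  by apply: ln_ge_rational; rewrite invf_ge1//; lra.
have h3 : (10 - 2 * k) / (8 - k) <= (1 - k / 4)^-1 `^ d.
  apply: le_trans h1; apply: (@le_trans _ _ (1 + d * (2 * k / (8 - k)))).
    have -> : d * (2 * k / (8 - k)) = 2 * (d * k) / (8 - k) by ring.
    by rewrite dk le_eqVlt; apply/orP; left; apply/eqP; field.
  by rewrite lerD2l ler_wpM2l.
rewrite -[1 - k / 4]invrK -[_^-1 in leLHS]powR_inv1 ?(ltW zV0)//.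
rewrite powRAC powR_inv1 ?powR_ge0// -[leRHS]invf_div.
rewrite lef_pV2 ?posrE ?powR_gt0//.
by rewrite divr_gt0//; lra.
Qed.

(** The line runs just below the chord of the square root over this interval. *)
Lemma sqrt_ge_affine (R : realType) (k : R) : 327 / 173 <= k -> k <= 2 ->
  698 / 1000 + 358 / 1000 * k <= Num.sqrt k.
Proof.
move=> kl k2; rewrite -[leLHS]ger0_norm; last lra.
by rewrite -sqrtr_sqr ler_wsqrtr//; nra.
Qed.

(** For [m = 0.364] and [l = 0.688], [(m + l z)^2 = (m - l z)^2 + 4 m l z] with [4 m l] barely above
    1. The line is almost tangent at [z = m/l], about 0.529, close to [1 - k/4] at [k = 327/173]. *)
Lemma sqrt_le_affine (R : realType) (z : R) : 0 <= z ->
  Num.sqrt z <= 364 / 1000 + 688 / 1000 * z.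
Proof.
move=> z0; rewrite -[leRHS]ger0_norm; last lra.
rewrite -sqrtr_sqr ler_wsqrtr//.
have := sqr_ge0 (364 / 1000 - 688 / 1000 * z); nra.
Qed.

Lemma copson_threshold_poly (R : realType) (k : R) : 327 / 173 <= k -> k <= 2 ->
  4 * k * (5 - k) * (k + 1)
    + (4 - k) * (8 - k) * (k + 1) * (364 / 1000 + 688 / 1000 * (1 - k / 4))
  <= 4 * (5 - k) * (4 * k - 2) * (698 / 1000 + 358 / 1000 * k).
Proof.
move=> kl k2.
(* Shifting the tight endpoint to [h = 0] leaves a polynomial inequality on a short interval of [h],
   within reach of [nra]. *)
have [h kE] : exists h, k = 327 / 173 + h by exists (k - 327 / 173); lra.
have h0 : 0 <= h by lra.
have h1 : h <= 11 / 100 by lra.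
rewrite kE; nra.
Qed.

(** With [k = (1 - p)/p] and [1/(1 - p) = 1 + 1/k], this is the hypothesis on [p] divided by
    [2^(1/k)]; the range of [k] is [1/3 <= p <= 0.346]. *)
Lemma copson_threshold (R : realType) (k : R) : 327 / 173 <= k -> k <= 2 ->
  k + 2 * (1 - k / 4) * (1 - k / 4) `^ k^-1 <= k * k `^ k^-1.
Proof.
move=> kl k2; have k1 : 1 <= k by lra.
have k0 : 0 < k by lra.
have z0 : 0 < 1 - k / 4 by lra.
have k10 : k + 1 != 0 by lra.
have k50 : 5 - k != 0 by lra.
have num0 : 0 <= (4 * k - 2) / (k + 1) by rewrite divr_ge0//; lra.
have den0 : 0 < 4 * (5 - k) * (k + 1) by rewrite !mulr_gt0//; lra.
have L0 : 0 <= 698 / 1000 + 358 / 1000 * k by lra.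
rewrite !powR_inv_split//.
pose L := 698 / 1000 + 358 / 1000 * k.
pose M := 364 / 1000 + 688 / 1000 * (1 - k / 4).
apply: (@le_trans _ _ (k + 2 * (1 - k / 4) * (M * ((8 - k) / (10 - 2 * k))))).
  rewrite lerD2l ler_wpM2l//; first by rewrite mulr_ge0// ltW.
  rewrite ler_pM ?sqrtr_ge0 ?powR_ge0 ?powR_deficit_le//.
  by apply: sqrt_le_affine; exact: ltW.
apply: (@le_trans _ _ (L * ((4 * k - 2) / (k + 1)))); last first.
  rewrite [leRHS]mulrCA; apply: ler_pM => //; first exact: sqrt_ge_affine.
  exact: powR_excess_ge.
rewrite -(ler_pM2l den0).
have -> : 4 * (5 - k) * (k + 1) *
    (k + 2 * (1 - k / 4) * (M * ((8 - k) / (10 - 2 * k)))) =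
  4 * k * (5 - k) * (k + 1) + (4 - k) * (8 - k) * (k + 1) * M.
  field; lra.
have -> : 4 * (5 - k) * (k + 1) * (L * ((4 * k - 2) / (k + 1))) =
  4 * (5 - k) * (4 * k - 2) * L by field.
exact: copson_threshold_poly.
Qed.

(** * Optimality of the constant *)

(** The right-hand side is the integral of [t^(-r-1)] over [[x, x + 1]], the left-hand side the
    least value of the integrand there. The proof uses only [ln (1 + t) <= t] and [e^t >= 1 + t]. *)
Lemma powR_step_le (R : realType) (r x : R) : 0 < r -> 0 < x ->
  (x + 1) `^ (- r - 1) <= (x `^ (- r) - (x + 1) `^ (- r)) / r.
Proof.
move=> r0 x0; have x10 : 0 < x + 1 by lra.
rewrite ler_pdivlMr// lerBrDr.
have z0 : 0 < x / (x + 1) by rewrite divr_gt0.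
have h1 := powR_ge1Dln _ _ (- r) z0.
have h2 : ln (x / (x + 1)) <= - (x + 1)^-1.
  have -> : x / (x + 1) = 1 + - (x + 1)^-1 by field; lra.
  by apply: le_ln1Dx; rewrite ltrN2 invf_lt1//; lra.
have h3 : 1 + r / (x + 1) <= (x / (x + 1)) `^ (- r).
  apply: le_trans h1; rewrite lerD2l mulNr -mulrN.
  by rewrite ler_wpM2l ?(ltW r0)// lerNr.
have -> : x `^ (- r) = (x + 1) `^ (- r) * (x / (x + 1)) `^ (- r).
  by rewrite -powRM ?(ltW x10) ?(ltW z0)// mulrC divfK ?gt_eqF.
have -> : (x + 1) `^ (- r) = (x + 1) * (x + 1) `^ (- r - 1).
  by rewrite -powRD1//; congr (_ `^ _); ring.
set w := _ `^ (- r - 1); have w0 : 0 <= w by exact: powR_ge0.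
have -> : w * r + (x + 1) * w = (x + 1) * w * (1 + r / (x + 1)) by field; lra.
by rewrite ler_wpM2l// mulr_ge0// ltW.
Qed.

Lemma sum_powR_tail_le (R : realType) (r : R) (n m : nat) :
  0 < r -> (1 <= n)%N ->
  \sum_(n <= k < m) k%:R `^ (- r - 1) <=
  n%:R `^ (- r - 1) + n%:R `^ (- r) / r.
Proof.
move=> r0 n1.
have [mn|nm] := leqP m n.
  by rewrite big_geq// addr_ge0 ?divr_ge0 ?powR_ge0// ltW.
(* Keeping the telescoping remainder on the left makes the bound inductive. *)
suff : \sum_(n <= k < m) k%:R `^ (- r - 1) + m.-1%:R `^ (- r) / r <=
    n%:R `^ (- r - 1) + n%:R `^ (- r) / r.
  by apply: le_trans; rewrite lerDl divr_ge0 ?powR_ge0// ltW.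
case: m nm => // m; rewrite ltnS/= => /subnKC <-.
elim: (m - n)%N => [|d IH]; first by rewrite addn0 big_nat1.
rewrite big_nat_recr/=; last exact: leq_addr.
apply: le_trans IH.
rewrite !addnS -addrA lerD2l -natr1.
have x0 : 0 < (n + d)%:R :> R by rewrite ltr0n addn_gt0 n1.
have := powR_step_le _ _ _ r0 x0; rewrite mulrBl; lra.
Qed.

Lemma harmonic_sum_unbounded (R : realType) (M : R) :
  exists N, M < \sum_(1 <= n < N.+1) n%:R^-1.
Proof.
apply: contrapT => h; apply: (@dvg_harmonic R).
apply: nondecreasing_is_cvgn.
  by apply: nondecreasing_series => n _ _; exact: harmonic_ge0.
exists M => _ [n _ <-]; rewrite leNgt; apply/negP => hn; apply: h; exists n.
by rewrite big_add1.
Qed.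

(** For the truncation at [N], with [H] the harmonic sum up to [N], the left side is at most
    [c H + D] with [D] independent of [N], while the right-hand series is at least [H]. So [C > c]
    fails once [H > D/(C - c)]. *)
Lemma copson_constant_optimal (R : realType) (p C : R) :
  0 < p -> p < 1 -> (p / (1 - p)) `^ p < C ->
  exists a : nat -> R, nonneg_seq a /\ ~ copson_ineq p C a.
Proof.
move=> p0 p1 hC; have q0 : 0 < 1 - p by lra.
set k := p / (1 - p) in hC *; have k0 : 0 < k by rewrite divr_gt0.
set c := k `^ p in hC *; have c0 : 0 < c by rewrite powR_gt0.
have ck0 : 0 <= c / k by rewrite ltW// divr_gt0.
(* The factor 2 bounds the sum of [1/n^2]. *)
pose D := 2 * (c / k).
have [N HN] := harmonic_sum_unbounded R (D / (C - c)).
pose a n : R := if (n <= N)%N then n%:R `^ (- k^-1 - 1) else 0.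
have a0 n : 0 <= a n by rewrite /a; case: ifP => // _; exact: powR_ge0.
exists a; split; first by move=> n _; exact: a0.
(* The exponent [-1/p] has the shape [-r - 1] of the tail estimate with [r = 1/k]. *)
have kp : - k^-1 - 1 = - p^-1 by rewrite /k; field; rewrite !gt_eqF.
have apE n : a n `^ p = if (n <= N)%N then n%:R^-1 else 0.
  rewrite /a; case: ifP => _; last by rewrite powR0 ?gt_eqF.
  by rewrite kp -powRrM mulNr mulVf ?gt_eqF// powR_inv1.
pose H : R := \sum_(1 <= n < N.+1) n%:R^-1.
(* For [n <= N] the tail estimate bounds the mean by [k n^(-1/p) (1 + 1/(kn))]; as
   [(1 + z)^p <= 1 + z], its power [p] is at most [c/n] plus a summable error [c/(k n^2)]. *)
have term n : (1 <= n)%N ->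
    (((n%:R^-1)%:E * \sum_(n <= i <oo) (a i)%:E) `^ p <=
     (c * a n `^ p + c / k * n%:R `^ (-1 - 1))%:E)%E.
  move=> n1; have n0 : 0 < n%:R :> R by rewrite ltr0n.
  have [nN|Nn] := leqP n N; last first.
    rewrite eseries0; last first.
      by move=> i ni _; rewrite /a leqNgt (leq_trans Nn ni).
    rewrite mule0 poweR0r ?gt_eqF// lee_fin.
    by rewrite addr_ge0// mulr_ge0 ?powR_ge0 ?(ltW c0).
  pose T : R := n%:R `^ (- k^-1 - 1) + n%:R `^ (- k^-1) / k^-1.
  have T0 : 0 <= T by rewrite addr_ge0 ?divr_ge0 ?powR_ge0// invr_ge0 ltW.
  have hT : (\sum_(n <= i <oo) (a i)%:E <= T%:E)%E.
    apply: lime_le; first by apply: is_cvg_nneseries => i _ _; rewrite lee_fin.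
    apply: nearW => m; rewrite sumEFin lee_fin.
    apply: le_trans (_ : \sum_(n <= i < m) i%:R `^ (- k^-1 - 1) <= _).
      by apply: ler_sum => i _; rewrite /a; case: ifP => // _; exact: powR_ge0.
    by apply: sum_powR_tail_le; rewrite ?invr_gt0.
  apply: (@le_trans _ _ ((n%:R^-1 * T)%:E `^ p)%E).
    apply: gt0_ler_poweR; first exact: ltW.
    - by rewrite in_itv/= leey andbT mule_ge0 ?lee_fin ?invr_ge0//;
        apply: nneseries_ge0 => i _ _; rewrite lee_fin.
    - by rewrite in_itv/= leey andbT lee_fin mulr_ge0 ?invr_ge0.
    by rewrite EFinM lee_pmul2l// lte_fin invr_gt0.
  rewrite poweR_EFin lee_fin apE nN.
  have -> : n%:R^-1 * T = k * n%:R `^ (- p^-1) * (1 + (k * n%:R)^-1).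
    have -> : T = n%:R `^ (- p^-1) * (1 + k * n%:R).
      have -> : - p^-1 = - k^-1 - 1 by [].
      have e : n%:R `^ (- k^-1) = n%:R * n%:R `^ (- k^-1 - 1).
        by rewrite -powRD1// subrK.
      rewrite /T e; field; by rewrite gt_eqF.
    by field; rewrite !gt_eqF.
  have z0 : 0 < (k * n%:R)^-1 by rewrite invr_gt0 mulr_gt0.
  have kn0 : 0 <= k * n%:R `^ (- p^-1) by rewrite mulr_ge0 ?powR_ge0 ?(ltW k0).
  have z10 : 0 <= 1 + (k * n%:R)^-1 by lra.
  rewrite (powRM _ kn0 z10) (powRM _ (ltW k0) (powR_ge0 _ _)).
  rewrite -powRrM mulNr mulVf ?gt_eqF// powR_inv1// -/c.
  have z1 : (1 + (k * n%:R)^-1) `^ p <= 1 + (k * n%:R)^-1.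
    by apply: ler1_powR; lra.
  have cn0 : 0 <= c / n%:R by rewrite divr_ge0// ltW.
  apply: le_trans (ler_wpM2l cn0 z1) _.
  have -> : -1 - 1 = - 2%:R :> R by lra.
  rewrite powR_invn// le_eqVlt; apply/orP; left; apply/eqP.
  by field; rewrite !gt_eqF.
move=> hineq.
have upper : (copson_lhs p a <= (c * H + D)%:E)%E.
  apply: lime_le; first by apply: is_cvg_nneseries => n _ _; exact: poweR_ge0.
  near=> M.
  have NM : (N.+1 <= M)%N by near: M; exact: nbhs_infty_ge.
  apply: (@le_trans _ _ (\sum_(1 <= n < M)
      (c * a n `^ p + c / k * n%:R `^ (-1 - 1))%:E)%E).
    rewrite big_nat [leRHS]big_nat.
    by apply: lee_sum => n /andP[n1 _]; exact: term.
  rewrite sumEFin lee_fin big_split/= -!mulr_sumr lerD//.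
    rewrite ler_wpM2l ?(ltW c0)//.
    have tail0 : \sum_(N.+1 <= n < M) a n `^ p = 0.
      by rewrite big_nat big1// => n /andP[Nn _]; rewrite apE leqNgt Nn.
    rewrite (@big_cat_nat _ _ _ N.+1)//= tail0 addr0.
    rewrite le_eqVlt; apply/orP; left; apply/eqP.
    by apply: eq_big_nat => n /andP[_]; rewrite ltnS apE => ->.
  rewrite /D mulrC ler_wpM2r//.
  have := @sum_powR_tail_le R 1 1 M ltr01 isT.
  by rewrite !powR1 divr1.
have lower : (H%:E <= copson_rhs p a)%E.
  apply: (le_trans _ (@nneseries_lim_ge _ _ xpredT 1 N.+1 _)); last first.
    by move=> n _ _; rewrite lee_fin powR_ge0.
  rewrite sumEFin lee_fin le_eqVlt; apply/orP; left; apply/eqP.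
  by apply: eq_big_nat => n /andP[_]; rewrite ltnS apE => ->.
have C0 : 0 < C by lra.
have : (C%:E * H%:E <= (c * H + D)%:E)%E.
  apply: le_trans upper; apply: le_trans hineq.
  by rewrite lee_pmul2l// lte_fin.
rewrite -EFinM lee_fin => hh.
move: HN; rewrite -/H ltr_pdivrMr ?subr_gt0// => HN.
lra.
Unshelve. all: by end_near. Qed.

(** * The criterion for [1/3 < p <= 0.346], and assembly of the ranges of [p] *)

Lemma copson_criterion_of_le (R : realType) (p : R) :
  1 / 3 < p -> p <= 346 / 1000 ->
  0 <= 2 `^ (p / (1 - p))
         * (((1 - p) / p) `^ (1 / (1 - p)) - (1 - p) / p)
       - (1 + (3 - 1 / p) / 2) `^ (1 / (1 - p)).
Proof.
move=> p3 p346; have p0 : 0 < p by lra.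
have q0 : 0 < 1 - p by lra.
set K := (1 - p) / p.
have Kl : 327 / 173 <= K by rewrite ler_pdivlMr//; lra.
have K2 : K <= 2 by rewrite ler_pdivrMr//; lra.
have K0 : 0 < K by lra.
have z0 : 0 < 1 - K / 4 by lra.
have zE : 1 + (3 - 1 / p) / 2 = 2 * (1 - K / 4).
  by rewrite /K; field; rewrite gt_eqF.
have sE : 1 / (1 - p) = K^-1 + 1.
  by rewrite /K; field; rewrite !gt_eqF.
have KV : p / (1 - p) = K^-1 by rewrite invf_div.
rewrite zE (powRM _ _ (ltW z0))// sE KV (powRD1 _ 2)// !powRD1//.
rewrite -mulrA (mulrCA 2) -mulrBr mulr_ge0 ?powR_ge0// subr_ge0 lerBrDl.
by rewrite mulrA; exact: copson_threshold.
Qed.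

Theorem theorem1p1 (R : realType) :
  (forall p : R,
     1 / 3 < p -> p < 1 / 2 ->
     0 <= 2 `^ (p / (1 - p))
            * (((1 - p) / p) `^ (1 / (1 - p)) - (1 - p) / p)
          - (1 + (3 - 1 / p) / 2) `^ (1 / (1 - p)) ->
     (forall a : nat -> R, nonneg_seq a ->
        copson_ineq p ((p / (1 - p)) `^ p) a)
     /\
     (forall C : R, (p / (1 - p)) `^ p < C ->
        exists a : nat -> R, nonneg_seq a /\ ~ copson_ineq p C a))
  /\
  (forall p : R,
     0 < p -> p <= 346 / 1000 ->
     forall a : nat -> R, nonneg_seq a ->
       copson_ineq p ((p / (1 - p)) `^ p) a).
Proof.
split=> [p p3 p2 hyp|p p0 p346 a a0].
  split=> [a a0|C hC]; first exact: copson_ineq_third_half.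
  by apply: copson_constant_optimal => //; lra.
have [p4|p4] := leP p (1 / 4); first exact: copson_ineq_small.
have [p3|p3] := leP p (1 / 3); first exact/copson_ineq_quarter_third/a0/p3/ltW.
apply: copson_ineq_third_half => //; first lra.
exact: copson_criterion_of_le.
Qed.
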